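(* Let $V$ and $W$ be pfd $B$-persistence modules and $\epsilon\ge0$. The following are equivalent: - (a) there exists a $\Lambda_\epsilon$-matching between $\mathscr{B}(V)$ and $\mathscr{B}(W)$; - (b) there exists a bottleneck $\Lambda_\epsilon$-interleaving between $V$ and $W$; - (c) there exists a $\Lambda_\epsilon$-interleaving between $V$ and $W$. Consequently, $$d_{\mathrm I}^{\Lambda}(V,W)=d_{\mathrm{BI}}^{\Lambda}(V,W)=d_{\mathrm B}^{\Lambda}(\mathscr{B}(V),\mathscr{B}(W)).$$
   Context: Let $k$ be a field. The bipath poset $B$ has underlying set $(\mathbb{R}\times\{1,2\})\sqcup\{-\infty,+\infty\}$. Its order is: $x\le y$ iff $x=-\infty$, or $y=+\infty$, or $x=(s,i)$ and $y=(t,i)$ for the same $i\in\{1,2\}$ with $s\le t$. A $B$-persistence module is a functor from $B$ (as a category) to $k$-vector spaces, with spaces $V_b$ and maps $V(b,b')$ for $b\le b'$; morphisms are natural transformations. It is pfd if all $V_b$ are finite-dimensional. An interval of $B$ is a nonempty subset that is convex ($p,q\in I$, $p\le r\le q$ imply $r\in I$) and connected (any two elements are joined by a finite sequence in $I$ with consecutive elements comparable). The interval module $k_I$ is $k$ on $I$ and $0$ elsewhere, with identity maps inside $I$ and zero maps otherwise. Every pfd $B$-module decomposes, uniquely up to isomorphism and permutation, into interval modules. $\mathscr{B}(V)$ is the multiset of its indecomposable summands; we identify $k_I$ with $I$. For $\epsilon\ge0$, $\Lambda_\epsilon\colon B\to B$ sends $(r,i)\mapsto(r+\epsilon,i)$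 and fixes $\pm\infty$. Define: - $V(\epsilon)_b=V_{\Lambda_\epsilon(b)}$ and $V(\epsilon)(b,b')=V(\Lambda_\epsilon b,\Lambda_\epsilon b')$; - for a morphism $\phi$, $\phi(\epsilon)$ has components $\phi_{\Lambda_\epsilon(b)}$; - $V_{0\to\epsilon}\colon V\to V(\epsilon)$ has components $V(b,\Lambda_\epsilon b)$. A $\Lambda_\epsilon$-interleaving is a pair $\alpha\colon V\to W(\epsilon)$, $\beta\colon W\to V(\epsilon)$ with $\beta(\epsilon)\circ\alpha=V_{0\to2\epsilon}$ and $\alpha(\epsilon)\circ\beta=W_{0\to2\epsilon}$. $V$ is $\Lambda_\epsilon$-trivial if $V_{0\to\epsilon}=0$. A bottleneck $\Lambda_\epsilon$-interleaving is a bijection $\sigma$ between a submultiset of $\mathscr{B}(V)$ and a submultiset of $\mathscr{B}(W)$ such that: - all unmatched summands are $\Lambda_{2\epsilon}$-trivial; - each $M$ is $\Lambda_\epsilon$-interleaved with $\sigma(M)$. For $A\subseteq B$, $A^\uparrow=\{p:\exists a\in A, a\le p\}$ and $A^\downarrow=\{p:\exists a\in A, p\le a\}$. Set $\mathrm{Ex}_\epsilon(A)=\Lambda_\epsilon^{-1}(A)^\uparrow\cap\Lambda_\epsilon(A)^\downarrow$, where $\Lambda_\epsilon^{-1}(A)$ is the preimage. A $\Lambda_\epsilon$-matching between multisets of intervals $\mathscr{A},\mathscr{C}$ is a bijection $\sigma$ between submultisets such that: - unmatched intervals $I$ have $k_I$ $\Lambda_{2\epsilon}$-trivial; - $\sigma(I)=J$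 implies $I\subseteq\mathrm{Ex}_\epsilon(J)$ and $J\subseteq\mathrm{Ex}_\epsilon(I)$. $d_{\mathrm I}^\Lambda$, $d_{\mathrm{BI}}^\Lambda$ and $d_{\mathrm B}^\Lambda$ are the infima of $\epsilon\ge0$ admitting, respectively, a $\Lambda_\epsilon$-interleaving, a bottleneck $\Lambda_\epsilon$-interleaving, and a $\Lambda_\epsilon$-matching ($\inf\emptyset=+\infty$). *)

(* Defs.v *)
From HB Require Import structures.
From mathcomp Require Import all_boot all_order all_algebra.
From mathcomp Require Import boolp classical_sets reals constructive_ereal ereal.
Set Implicit Arguments. Unset Strict Implicit. Unset Printing Implicit Defensive.
Import Order.TTheory GRing.Theory Num.Theory.
Local Open Scope classical_set_scope.
Local Open Scope ring_scope.

Inductive lane := lane1 | lane2.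
Definition lane_eqb (i j : lane) : bool :=
  match i, j with lane1, lane1 | lane2, lane2 => true | _, _ => false end.

Section Bipath.
Variable R : realType.

Inductive bip := bninf | bpinf | bpt of R & lane.

Definition ble (x y : bip) : bool :=
  match x, y with
  | bninf, _ => true
  | _, bpinf => true
  | bpt s i, bpt t j => lane_eqb i j && (s <= t)
  | _, _ => false
  end.

Definition shift (e : R) (x : bip) : bip :=
  match x with bpt r i => bpt (r + e) i | y => y end.

Definition comparable (x y : bip) : bool := ble x y || ble y x.

Definition convexB (I : set bip) : Prop :=
  forall p q r, I p -> I q -> ble p r -> ble r q -> I r.
Definition connectedB (I : set bip) : Prop :=
  forall p q, I p -> I q ->
    exists s : seq bip, (forall i, (i < size s)%N -> I (nth p s i)) /\ path comparable p s /\ last p s = q.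
Definition intervalB (I : set bip) : Prop :=
  I !=set0 /\ convexB I /\ connectedB I.

Definition upset (A : set bip) : set bip := [set p | exists2 a, A a & ble a p].
Definition downset (A : set bip) : set bip := [set p | exists2 a, A a & ble p a].
Definition Ex (e : R) (A : set bip) : set bip :=
  upset (shift e @^-1` A) `&` downset (shift e @` A).

Variable k : fieldType.

(* A pfd B-module: finite-dimensional k-spaces (vectType) with linear maps
   V(b,b') for all pairs; only the maps for b <= b' are meaningful, and the
   functor laws are the predicate [is_module]. *)
Record pmod := PMod {
  sp : bip -> vectType k;
  mp : forall b b', 'Hom(sp b, sp b')
}.

Definition is_module (V : pmod) : Prop :=
  (forall b, mp V b b = \1%VF) /\
  (forall b b' b'', ble b b' -> ble b' b'' ->
     mp V b b'' = (mp V b' b'' \o mp V b b')%VF).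

(* Interval module k_I : k on I, 0 off I, identity maps inside I. *)
Definition kI (I : set bip) : pmod :=
  @PMod (fun b => [the vectType k of 'rV[k]_(`[< I b >] : nat)])
        (fun b b' => linfun (mulmxr (const_mx 1 : 'M[k]_(`[< I b >] : nat, `[< I b' >] : nat)))).

Definition trivial_mod (e : R) (V : pmod) : Prop :=
  forall b, mp V b (shift e b) = 0.

Definition morph_shift (e : R) (V W : pmod)
    (a : forall b, 'Hom(sp V b, sp W (shift e b))) : Prop :=
  forall b b', ble b b' ->
    (mp W (shift e b) (shift e b') \o a b = a b' \o mp V b b')%VF.

(* Lambda_eps-interleaving; note Lambda_eps o Lambda_eps = Lambda_{2 eps},
   so V_{0 -> 2eps} at b is V(b, Lambda_eps (Lambda_eps b)). *)
Definition interleaved (e : R) (V W : pmod) : Prop :=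
  exists (a : forall b, 'Hom(sp V b, sp W (shift e b)))
         (c : forall b, 'Hom(sp W b, sp V (shift e b))),
    morph_shift a /\ morph_shift c /\
    (forall b, (c (shift e b) \o a b)%VF = mp V b (shift e (shift e b))) /\
    (forall b, (a (shift e b) \o c b)%VF = mp W b (shift e (shift e b))).

(* A barcode of V: a multiset of intervals, given as an indexed family
   (I j)_{j : J}, such that V is isomorphic to the direct sum of the k_{I j}:
   i.e. there are vectors e b j in V_b such that for each b, (e b j)_{b \in I j}
   (a finite family) is a basis of V_b and the structure maps act on these
   basis vectors as in the direct sum of the interval modules. *)
Definition barcode (V : pmod) (J : eqType) (I : J -> set bip) : Prop :=
  (forall j, intervalB (I j)) /\
  exists e : forall b, J -> sp V b,
    (forall b, exists s : seq J,
        (forall j, I j b <-> j \in s) /\ basis_of fullv [seq e b j | j <- s]) /\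
    (forall b b' j, ble b b' -> I j b ->
        mp V b b' (e b j) = if `[< I j b' >] then e b' j else 0).

Definition pbij (J1 J2 : Type) (s : J1 -> J2 -> Prop) : Prop :=
  (forall j j1 j2, s j j1 -> s j j2 -> j1 = j2) /\
  (forall j1 j2 j, s j1 j -> s j2 j -> j1 = j2).

Definition gmatch (e : R) (J1 J2 : Type) (I1 : J1 -> set bip) (I2 : J2 -> set bip)
    (P : set bip -> set bip -> Prop) : Prop :=
  exists s : J1 -> J2 -> Prop, pbij s /\
    (forall j, (forall j', ~ s j j') -> trivial_mod (2 * e) (kI (I1 j))) /\
    (forall j', (forall j, ~ s j j') -> trivial_mod (2 * e) (kI (I2 j'))) /\
    (forall j j', s j j' -> P (I1 j) (I2 j')).

Definition Lmatching (e : R) (J1 J2 : Type) (I1 : J1 -> set bip) (I2 : J2 -> set bip) :=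
  gmatch e I1 I2 (fun I J => I `<=` Ex e J /\ J `<=` Ex e I).

Definition bottleneck (e : R) (J1 J2 : Type) (I1 : J1 -> set bip) (I2 : J2 -> set bip) :=
  gmatch e I1 I2 (fun I J => interleaved e (kI I) (kI J)).

(* infimum over eps >= 0 satisfying P, in the extended reals (inf set0 = +oo) *)
Definition dinf (P : R -> Prop) : \bar R :=
  ereal_inf [set x%:E | x in [set x | 0 <= x /\ P x]].

Definition dI (V W : pmod) := dinf (fun e => interleaved e V W).
Definition dBI (J1 J2 : Type) (I1 : J1 -> set bip) (I2 : J2 -> set bip) :=
  dinf (fun e => bottleneck e I1 I2).
Definition dB (J1 J2 : Type) (I1 : J1 -> set bip) (I2 : J2 -> set bip) :=
  dinf (fun e => Lmatching e I1 I2).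

End Bipath.

(* Main.v *)
(* Every interval is of one of five kinds, according to which of the two ends of
   the bipath it contains and, failing both, to its lane; it is then determined
   by two cuts of the real line.  With suitable orientations, a nonzero morphism
   k_I -> k_J(e) between intervals of the same kind forces each cut of J to lie
   in the e-translate of the corresponding cut of I, and I, J are
   e-matched iff this holds in both directions.  Nonzero morphisms between
   different kinds never form cycles, so an interleaving restricts to the
   summands of each kind.  If I -> J(e) and J -> K(e) are nonzero and the sum of
   the two cut positions of K is not smaller than that of I, then J is matched
   with I or with K.  Hence, for finitely many non-2e-trivial summands sorted by
   this sum, the scalars linking them with their possible partners give two
   matrices with unitriangular product: this is Hall's condition.  Hall's theorem
   for locally finite graphs, applied on both sides, produces the matching.
   Conversely a matching of the bases is an interleaving, and the statement on
   bottleneck interleavings follows by applying both implications to pairs of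
   interval modules. *)
Require Import Defs.
From HB Require Import structures.
From mathcomp Require Import all_boot all_order all_algebra.
From mathcomp Require Import boolp classical_sets filter reals constructive_ereal ereal.
From mathcomp Require Import lra.
Set Implicit Arguments.
Unset Strict Implicit.
Unset Printing Implicit Defensive.
Import Order.TTheory GRing.Theory Num.Theory.
Local Open Scope classical_set_scope.
Local Open Scope ring_scope.

(** * Hall's theorem for finite and locally finite graphs *)

Section Hall.
Variables X Y : eqType.
Implicit Types (N : X -> seq Y) (A B : seq X).

Definition nbh N B := undup (flatten [seq N x | x <- B]).

Definition hall_cond N (P : X -> Prop) :=
  forall B, uniq B -> (forall x, x \in B -> P x) -> (size B <= size (nbh N B))%N.

Lemma mem_nbh N B y : reflect (exists2 x, x \in B & y \in N x) (y \in nbh N B).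
Proof. by rewrite mem_undup; apply: (iffP flatten_mapP). Qed.

(** Halmos-Vaughan induction: a nonempty proper subset [B] with exactly as many neighbours as
    elements splits the problem into [B] and the rest deprived of the neighbours of [B]. Without
    such a tight subset, any edge at the head of [A] may be fixed. *)
Lemma finite_hall (y0 : Y) n N A : (size A <= n)%N -> uniq A ->
  hall_cond N (fun x => x \in A) ->
  exists f : X -> Y, {in A &, injective f} /\ {in A, forall x, f x \in N x}.
Proof.
elim: n N A => [|n IH] N A sA uA hA.
  by exists (fun=> y0); case: A sA {uA hA}.
have [[B [uB BA B0 sBA sNB]]|noB] := pselect (exists B, [/\ uniq B,
    {subset B <= A}, B != [::], (size B < size A)%N & size (nbh N B) = size B]).
  have [|//|f1 [f1inj f1N]] := IH N B _ uB; first by rewrite -ltnS; exact: leq_trans sA.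
    by move=> C uC CB; apply: hA => // x /CB /BA.
  pose A' := [seq x <- A | x \notin B].
  pose N' x := [seq y <- N x | y \notin nbh N B].
  have sizeA' : (size A' < size A)%N.
    rewrite ltn_neqAle size_filter count_size andbT -all_count.
    apply/negP => /allP h; case: B B0 BA h {uB sBA sNB f1inj f1N A' N'} => // b B _ BA.
    by move=> /(_ b (BA _ (mem_head _ _))); rewrite mem_head.
  have [||//|f2 [f2inj f2N]] := IH N' A'.
  - by rewrite -ltnS; exact: leq_trans sA.
  - exact: filter_uniq.
  - move=> C uC CA'.
    have uBC : uniq (B ++ C).
      rewrite cat_uniq uB uC andbT /=; apply/hasPn => x /CA'.
      by rewrite mem_filter => /andP[].
    have := hA _ uBC; rewrite size_cat => h.
    rewrite -(leq_add2l (size B)); apply: leq_trans (h _) _.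
      by move=> x; rewrite mem_cat => /orP[/BA//|/CA']; rewrite mem_filter => /andP[].
    rewrite -{1}sNB -size_cat; apply: uniq_leq_size => [|y]; first exact: undup_uniq.
    move=> /mem_nbh[x]; rewrite mem_cat => xBC yNx; rewrite mem_cat.
    have [//|yB/=] := boolP (y \in nbh N B); apply/mem_nbh; exists x; last first.
      by rewrite mem_filter yB.
    by case/orP: xBC => // xB; case/negP: yB; apply/mem_nbh; exists x.
  have f12 x z : x \in A -> z \in A -> x \in B -> z \notin B -> f1 x != f2 z.
    move=> xA zA xB zB; have := f2N z; rewrite mem_filter zB zA mem_filter => /(_ isT).
    move=> /andP[+ _]; apply: contraNneq => <-; apply/mem_nbh; exists x => //; exact: f1N.
  exists (fun x => if x \in B then f1 x else f2 x); split=> [x z xA zA|x xA].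
    have [xB|xB] := boolP (x \in B); have [zB|zB] := boolP (z \in B).
    - exact: f1inj.
    - by move=> e; have := f12 _ _ xA zA xB zB; rewrite e eqxx.
    - by move=> e; have := f12 _ _ zA xA zB xB; rewrite e eqxx.
    - by apply: f2inj; rewrite mem_filter ?xB ?zB.
  have [xB|xB] := boolP (x \in B); first exact: f1N.
  by have := f2N x; rewrite mem_filter xB xA mem_filter => /(_ isT)/andP[].
case: A sA uA hA noB => [|x A] /= sA uA hA noB; first by exists (fun=> y0).
have [y yNx] : exists y, y \in N x.
  have : (0 < size (nbh N [:: x]))%N.
    by apply: (hA [:: x]) => // z; rewrite !inE => ->.
  rewrite /nbh /= cats0; case: (N x) => //= y s _; exists y; exact: mem_head.
pose N' z := [seq t <- N z | t != y].
case/andP: uA => xA uA.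
have [||f [finj fN]] := IH N' A sA; first exact: uA.
  move=> C uC CA.
  have [->//|C0] := eqVneq C [::].
  have sCA : (size C < (size A).+1)%N by rewrite ltnS; exact: uniq_leq_size.
  have CxA : {subset C <= x :: A} by move=> z /CA; rewrite inE orbC => ->.
  (* [C] omits [x], so it is smaller than [x :: A]; not being tight, it has a neighbour to spare,
     which pays for the removal of [y]. *)
  have lt : (size C < size (nbh N C))%N.
    rewrite ltn_neqAle hA // andbT; apply/eqP => e.
    by apply: noB; exists C; split.
  rewrite -ltnS; apply: leq_trans lt _.
  apply: (@uniq_leq_size _ _ (y :: nbh N' C)) => [|t]; first exact: undup_uniq.
  move=> /mem_nbh[z zC tz]; rewrite inE; have [//|ty/=] := eqVneq t y.
  by apply/mem_nbh; exists z => //; rewrite mem_filter ty.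
have fy z : z \in A -> f z != y by move=> /fN; rewrite mem_filter => /andP[].
have xz z : z \in A -> (z == x) = false by move=> zA; apply: contraNF xA => /eqP <-.
exists (fun z => if z == x then y else f z); split=> [z t|z]; rewrite !inE.
  case: eqVneq => [-> _|_ /= zA]; case: eqVneq => [-> //|_ /= tA].
  - by move=> e; move: (fy _ tA); rewrite -e eqxx.
  - by move=> _ e; move: (fy _ zA); rewrite e eqxx.
  - exact: finj.
by case: eqVneq => [-> //|_ /= /fN]; rewrite mem_filter => /andP[].
Qed.

(* A system of partial matchings on finite sets is glued along an ultrafilter
   finer than the "eventually contains x" filter on finite subsets; local
   finiteness of N forces the image of each point to be eventually constant. *)
Lemma locally_finite_hall (P : X -> Prop) N : hall_cond N P ->
  exists m : X -> Y -> Prop,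
    [/\ forall x, P x -> exists y, m x y,
        forall x y, m x y -> P x /\ y \in N x,
        forall x y y', m x y -> m x y' -> y = y' &
        forall x x' y, m x y -> m x' y -> x = x'].
Proof.
move=> hN.
have [[x0 Px0]|noP] := pselect (exists x, P x); last first.
  by exists (fun _ _ => False); split=> // x Px; case: noP; exists x.
have [y0 _] : exists y, y \in N x0.
  have : (0 < size (nbh N [:: x0]))%N.
    by apply: (hN [:: x0]) => // z; rewrite inE => /eqP->.
  rewrite /nbh /= cats0; case: (N x0) => //= y s _; exists y; exact: mem_head.
pose Q A := undup [seq x <- A | `[< P x >]].
have QP A x : (x \in Q A) = (x \in A) && `[< P x >].
  by rewrite mem_undup mem_filter andbC.
have /choice[f fP] : forall A, exists f : X -> Y,
    {in Q A &, injective f} /\ {in Q A, forall x, f x \in N x}.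
  move=> A; apply: (finite_hall y0 (leqnn _)); first exact: undup_uniq.
  by move=> B uB BQ; apply: hN => // x /BQ; rewrite QP => /andP[_ /asboolP].
pose F : set_system (seq X) := [set S | exists B : seq X,
  forall A : seq X, {subset B <= A} -> S A].
have FF : ProperFilter F.
  apply: Build_ProperFilter_ex; first by move=> S [B SB]; exists B; exact: SB.
  split; first by exists [::].
    move=> S T [B SB] [C TC]; exists (B ++ C) => A BCA; split.
      by apply: SB => x xB; apply: BCA; rewrite mem_cat xB.
    by apply: TC => x xB; apply: BCA; rewrite mem_cat xB orbT.
  by move=> S T ST [B SB]; exists B => A /SB /ST.
have [U [UU FU]] := ultraFilterLemma FF.
have Uin x : U [set A | x \in A].
  by apply: FU; exists [:: x] => A; apply; exact: mem_head.
exists (fun x y => P x /\ U [set A | x \in A /\ f A x = y]); split.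
- move=> x Px.
  suff : exists2 y, y \in N x & U [set A | x \in A /\ f A x = y] by move=> [y _ ?]; exists y.
  apply: contrapT => noy.
  (* If no value in [N x] is taken on a [U]-large set, values can be excluded one at a time. As
     [N x] is finite, all of them end up excluded together. *)
  have : forall s : seq Y, {subset s <= N x} -> U [set A | x \in A /\ f A x \notin s].
    elim=> [_|y s IH sN].
      by apply: filterS (Uin x) => A.
    have [|Us] := in_ultra_setVsetC [set A | x \in A /\ f A x = y] UU.
      by move=> ?; case: noy; exists y => //; apply: sN; exact: mem_head.
    have /IH Us' : {subset s <= N x} by move=> z zs; apply: sN; rewrite inE zs orbT.
    apply: filterS (filterI Us Us') => A /= [nA [xA fA]]; split=> //.
    by rewrite inE negb_or fA andbT; apply: contra_notN nA => /eqP.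
  move=> /(_ (N x) (fun _ => id)) Uno.
  have [A [/= xA /negP[]]] := filter_ex Uno.
  by apply: (fP A).2; rewrite QP xA; apply/asboolP.
- move=> x y [Px Uy]; split=> //.
  have [A [/= xA <-]] := filter_ex Uy.
  by apply: (fP A).2; rewrite QP xA; apply/asboolP.
- move=> x y y' [Px Uy] [_ Uy'].
  by have [A [/= [_ <-] [_ <-]]] := filter_ex (filterI Uy Uy').
- move=> x x' y [Px Uy] [Px' Uy'].
  have [A [/= [xA e] [x'A e']]] := filter_ex (filterI Uy Uy').
  apply: (fP A).1; rewrite ?e ?e' // QP ?xA ?x'A; exact/asboolP.
Qed.

End Hall.

(** * Merging two one-sided matchings *)

(* Mendelsohn-Dulmage: [Z] collects the points of X reached by alternating
   chains that start at a point outside the image of g. *)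
Section Merge.
Variables (X Y : Type) (P : X -> Prop) (Q : Y -> Prop).
Variables (f : X -> Y -> Prop) (g : Y -> X -> Prop).

Inductive chain : X -> Prop :=
| chain_start x : P x -> (forall y, ~ g y x) -> chain x
| chain_step z y x : chain z -> f z y -> g y x -> P x -> chain x.

(** Chain points are matched by [f], the others by [g]. A point of [P] off the chains is in the
    image of [g] by [chain_start], and by [chain_step] its [g]-partner is not taken by a chain
    point. *)
Lemma merge_matchings :
  (forall x, P x -> exists y, f x y) -> (forall y, Q y -> exists x, g y x) ->
  (forall x y y', f x y -> f x y' -> y = y') ->
  (forall x x' y, f x y -> f x' y -> x = x') ->
  (forall y x x', g y x -> g y x' -> x = x') ->
  (forall y y' x, g y x -> g y' x -> y = y') ->
  exists s : X -> Y -> Prop, [/\ pbij s,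
    forall x, P x -> exists y, s x y, forall y, Q y -> exists x, s x y &
    forall x y, s x y -> f x y \/ g y x].
Proof.
move=> fP gQ ffun finj gfun ginj.
exists (fun x y => (chain x /\ f x y) \/
   [/\ ~ chain x, g y x & ~ exists2 z, chain z & f z y]); split.
- split=> [x y y'|x x' y].
    move=> [[Zx fy]|[nZ gy _]] [[Zx' fy']|[nZ' gy' _]] //; first exact: (ffun x).
    exact: (ginj _ _ x).
  move=> [[Zx fy]|[nZ gy nf]] [[Zx' fy']|[nZ' gy' nf']].
  - exact: (finj _ _ y).
  - by case: nf'; exists x.
  - by case: nf; exists x'.
  - exact: (gfun y).
- move=> x Px; have [Zx|nZ] := pselect (chain x).
    by have [y fy] := fP x Px; exists y; left.
  have [[y gy]|nog] := pselect (exists y, g y x); last first.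
    by case: nZ; apply: chain_start => // y gy; apply: nog; exists y.
  exists y; right; split=> // -[z Zz fz]; apply: nZ; exact: chain_step Zz fz gy Px.
- move=> y Qy; have [[z Zz fz]|nof] := pselect (exists2 z, chain z & f z y).
    by exists z; left.
  have [x gx] := gQ y Qy; exists x; right; split=> // Zx.
  case: Zx gx => [{}x Px nog /nog //|z y' {}x Zz fz gy' Px gy].
  by apply: nof; exists z => //; rewrite (ginj _ _ _ gy gy').
- by move=> x y [[_ ?]|[_ ? _]]; [left|right].
Qed.

End Merge.

(** * Linear algebra over an indexed basis *)

Section BasisFamily.
Variables (k : fieldType) (vT : vectType k) (J : eqType) (s : seq J) (e : J -> vT).
Hypothesis bs : basis_of fullv [seq e j | j <- s].

Lemma basis_hom (rT : vectType k) (g : J -> rT) :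
  exists f : 'Hom(vT, rT), {in s, forall j, f (e j) = g j}.
Proof.
have [f fE] := linear_of_free [seq e j | j <- s] [seq g j | j <- s].
exists (linfun f) => j js; rewrite lfunE /=.
have := fE (basis_free bs); rewrite !size_map -map_comp => /(_ erefl)/eq_in_map.
exact.
Qed.

Lemma basis_hom_ext (rT : vectType k) (f g : 'Hom(vT, rT)) :
  {in s, forall j, f (e j) = g (e j)} -> f = g.
Proof.
move=> fg; apply/(fullv_lfunP _ _ (span_basis bs)) => _ /mapP[j js ->].
exact: fg.
Qed.

Lemma basis_coord : exists cf : J -> 'Hom(vT, k^o),
  {in s, forall j i, cf i (e j) = (j == i)%:R :> k} /\
  forall v, v = \sum_(i <- s) (cf i v : k) *: e i.
Proof.
have /choice[cf cfE] i := basis_hom (fun j => (j == i)%:R : k^o).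
exists cf; split=> [j js i|v]; first exact: cfE.
(* Rebuilding a vector from its coordinates is linear and fixes the basis, hence is the identity. *)
pose f v := \sum_(i <- s) (cf i v : k) *: e i.
have lin_f : linear f.
  move=> a u w; rewrite /f scaler_sumr -big_split /=; apply: eq_bigr => i _.
  by rewrite linearP scalerDl scalerA.
pose fL := GRing.isLinear.Build k vT vT *:%R f lin_f.
pose fl : {linear vT -> vT} := HB.pack f fL.
suff e1 : \1%VF = linfun fl by rewrite -[LHS]id_lfunE e1 lfunE.
apply: basis_hom_ext => j js; rewrite id_lfunE lfunE /= /f.
have us : uniq s by apply: (@map_uniq _ _ e); apply: free_uniq (basis_free bs).
rewrite (bigD1_seq j) //= cfE // eqxx scale1r big1 ?addr0 // => i /negPf ij.
by rewrite cfE // eq_sym ij scale0r.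
Qed.

End BasisFamily.

(** * Coordinates in a barcode basis; from matchings to interleavings *)

Section BarcodeCoordinates.
Variables (R : realType) (k : fieldType).
Implicit Types (V W : pmod R k) (b : bip R).

(** [cbase b j] is meaningful only when the bar [j] contains [b]. [chom] and [chom_ext] give the
    universal property of the basis. *)
Record coords V (J : eqType) (I : J -> set (bip R)) := Coords {
  cbase : forall b, J -> sp V b;
  csupp : bip R -> seq J;
  ccoord : forall b, J -> 'Hom(sp V b, k^o);
  csupp_uniq : forall b, uniq (csupp b);
  csuppP : forall b j, I j b <-> j \in csupp b;
  ccoordE : forall b j i, I j b -> ccoord b i (cbase b j) = (j == i)%:R :> k;
  ccoord_sum : forall b v,
    v = \sum_(i <- csupp b) (ccoord b i v : k) *: cbase b i;
  chom : forall b (rT : vectType k) (g : J -> rT),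
    exists f : 'Hom(sp V b, rT), forall j, I j b -> f (cbase b j) = g j;
  chom_ext : forall b (rT : vectType k) (f g : 'Hom(sp V b, rT)),
    (forall j, I j b -> f (cbase b j) = g (cbase b j)) -> f = g;
  cmap : forall b b' j, ble b b' -> I j b ->
    mp V b b' (cbase b j) = if `[< I j b' >] then cbase b' j else 0
}.

Lemma barcode_coords V (J : eqType) (I : J -> set (bip R)) :
  barcode V I -> exists _ : coords V I, True.
Proof.
move=> [_ [e [/choice[s sP] mapP]]].
have bs b := (sP b).2.
pose cf b := sval (cid (basis_coord (bs b))).
pose cfP b := svalP (cid (basis_coord (bs b))).
unshelve eexists; last by [].
apply: (@Coords V J I e s cf) => //.
- by move=> b; apply: (@map_uniq _ _ (e b)); apply: free_uniq (basis_free (bs b)).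
- by move=> b; exact: (sP b).1.
- by move=> b j i /(sP b).1 js; exact: (cfP b).1.
- by move=> b v; exact: (cfP b).2.
- move=> b rT g; have [f fE] := basis_hom (bs b) g.
  by exists f => j /(sP b).1; exact: fE.
- by move=> b rT f g fg; apply: (basis_hom_ext (bs b)) => j /(sP b).1; exact: fg.
Qed.

Lemma ccoord_map V (J : eqType) (I : J -> set (bip R)) (B : coords V I) b b' j v :
  ble b b' -> I j b' -> ccoord B b' j (mp V b b' v) = ccoord B b j v.
Proof.
move=> bb' jb'; rewrite -comp_lfunE; congr (fun_of_lfun _ v).
apply: (chom_ext (c := B)) => i ib; rewrite comp_lfunE (cmap _ bb') // ccoordE //.
have [ij|ij] := eqVneq i j; first by rewrite -ij in jb' *; rewrite asboolT // ccoordE // eqxx.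
by case: asboolP => ib'; rewrite ?linear0 // ccoordE // (negPf ij).
Qed.

Lemma ccoord_out V (J : eqType) (I : J -> set (bip R)) (B : coords V I) b j v :
  ~ I j b -> ccoord B b j v = 0.
Proof.
move=> jb; suff -> : ccoord B b j = 0 by rewrite zero_lfunE.
apply: (chom_ext (c := B)) => i ib; rewrite zero_lfunE ccoordE //.
by case: eqVneq ib => [->|].
Qed.

Lemma shift_mono (e : R) b b' : ble (shift e b) (shift e b') = ble b b'.
Proof. by case: b b' => [||s i] [||t j] //=; rewrite lerD2r. Qed.

Section HomCoefficients.
Variables (V W : pmod R k) (J1 J2 : eqType).
Variables (I1 : J1 -> set (bip R)) (I2 : J2 -> set (bip R)).
Variables (B1 : coords V I1) (B2 : coords W I2) (e : R).
Variables (a : forall b, 'Hom(sp V b, sp W (shift e b))).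

(** Matrix entry of [a b] in the barcode bases, with value 0 where [cbase B1 b j] carries no
    meaning. *)
Definition hom_coef b j j' : k :=
  if `[< I1 j b >]
  then ccoord B2 (shift e b) j' (a b (cbase B1 b j)) else 0.

Lemma hom_coef_neq0 b j j' : hom_coef b j j' != 0 -> I1 j b /\ I2 j' (shift e b).
Proof.
rewrite /hom_coef; case: asboolP => [jb n0|_ /eqP//]; split=> //.
have [//|nj] := pselect (I2 j' (shift e b)).
by rewrite ccoord_out ?eqxx in n0.
Qed.

Hypothesis am : morph_shift a.

Lemma hom_coef_natural b b' j j' : ble b b' -> I1 j b -> I2 j' (shift e b') ->
  hom_coef b j j' = hom_coef b' j j'.
Proof.
move=> bb' jb j'b'; rewrite /hom_coef asboolT //.
have := congr1 (fun f : 'Hom(_, _) => ccoord B2 (shift e b') j' (f (cbase B1 b j))) (am bb').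
rewrite !comp_lfunE /= ccoord_map ?shift_mono // => ->.
by rewrite (cmap _ bb') //; case: asboolP; rewrite // !linear0.
Qed.

Lemma hom_coef_sum b j : I1 j b -> a b (cbase B1 b j) =
  \sum_(j' <- csupp B2 (shift e b)) hom_coef b j j' *: cbase B2 (shift e b) j'.
Proof.
move=> jb; rewrite {1}(ccoord_sum B2 (a b _)); apply: eq_bigr => j' _.
by rewrite /hom_coef asboolT.
Qed.

End HomCoefficients.

Lemma hom_coef_comp V W (J1 J2 : eqType) (I1 : J1 -> set (bip R))
    (I2 : J2 -> set (bip R)) (B1 : coords V I1) (B2 : coords W I2) (e : R)
    (a : forall b, 'Hom(sp V b, sp W (shift e b)))
    (c : forall b, 'Hom(sp W b, sp V (shift e b))) b j i :
  0 <= e -> (c (shift e b) \o a b)%VF = mp V b (shift e (shift e b)) ->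
  I1 j b -> I1 i (shift e (shift e b)) ->
  \sum_(j' <- csupp B2 (shift e b))
     hom_coef B1 B2 a b j j' * hom_coef B2 B1 c (shift e b) j' i = (j == i)%:R.
Proof.
move=> e0 ca jb ib.
have bb : ble b (shift e (shift e b)).
  by case: b {ca jb ib} => //= s [] /=; rewrite -addrA lerDl addr_ge0.
have := congr1 (fun f : 'Hom(_, _) => ccoord B1 (shift e (shift e b)) i (f (cbase B1 b j))) ca.
rewrite /= ccoord_map // ccoordE // comp_lfunE (hom_coef_sum B1 B2) // !linear_sum /= => <-.
rewrite big_seq [RHS]big_seq; apply: eq_bigr => j' /(csuppP B2 _ _).2 j'b.
by rewrite !linearZ /= {2}/hom_coef asboolT.
Qed.

(** This makes the map sending generators of [I] to generators of [J] natural: the inclusions give a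
    point of each bar on the far side, and convexity fills in. *)
Lemma Ex_natural (e : R) (I J : set (bip R)) b b' :
  convexB I -> convexB J -> I `<=` Ex e J -> J `<=` Ex e I ->
  ble b b' -> I b -> J (shift e b') -> J (shift e b) /\ I b'.
Proof.
move=> cI cJ IJ JI bb' Ib Jb'.
have [[p Jp pb] _] := IJ _ Ib; have [_ [_ [q Iq <-] bq]] := JI _ Jb'; split.
  by apply: (cJ (shift e p) (shift e b')); rewrite ?shift_mono.
by apply: (cI b q) => //; rewrite shift_mono in bq.
Qed.

(** A bar that survives two shifts meets its partner halfway, so the composite through the partner
    is not killed midway. *)
Lemma Ex_middle (e : R) (I J : set (bip R)) b : convexB J -> I `<=` Ex e J ->
  I b -> I (shift e (shift e b)) -> J (shift e b).
Proof.
move=> cJ IJ Ib Ib2.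
have [[p Jp pb] _] := IJ _ Ib; have [_ [_ [q Jq <-] bq]] := IJ _ Ib2.
rewrite shift_mono in bq.
by apply: (cJ (shift e p) q); rewrite ?shift_mono.
Qed.

Lemma trivial_kIP (e : R) (I : set (bip R)) :
  trivial_mod (2 * e) (kI k I) <-> forall b, I b -> I (shift e (shift e b)) -> False.
Proof.
have shift2 b : shift (2 * e) b = shift e (shift e b).
  by case: b => //= r i; congr bpt; rewrite mulrDl mul1r addrA.
split=> [h b Ib Ib2|h b].
  have i : 'I_(`[< I (shift e (shift e b)) >] : nat) by rewrite asboolT //; exact: ord0.
  have := congr1 (fun f : 'Hom(_, _) => f (const_mx 1)) (h b).
  rewrite shift2 zero_lfunE lfunE /= => /matrixP/(_ ord0 i); rewrite !mxE.
  under eq_bigr do rewrite !mxE mul1r.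
  by rewrite sumr_const card_ord asboolT // => /eqP; rewrite oner_eq0.
apply/lfunP => v; rewrite shift2 zero_lfunE lfunE /=; apply/matrixP => i j.
rewrite !mxE; apply: big1 => t _; exfalso; apply: (h b).
  by case: asboolP t => // _ [].
by case: asboolP j => // _ [].
Qed.

Section OfMatching.
Variables (V W : pmod R k) (J1 J2 : eqType).
Variables (I1 : J1 -> set (bip R)) (I2 : J2 -> set (bip R)).
Variables (B1 : coords V I1) (B2 : coords W I2) (e : R).
Hypotheses (C1 : forall j, convexB (I1 j)) (C2 : forall j, convexB (I2 j)).
Variable (s : J1 -> J2 -> Prop).
Hypothesis sfun : forall j j1 j2, s j j1 -> s j j2 -> j1 = j2.
Hypothesis sEx1 : forall j j', s j j' -> I1 j `<=` Ex e (I2 j').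
Hypothesis sEx2 : forall j j', s j j' -> I2 j' `<=` Ex e (I1 j).

Definition matched_vec b j : sp W (shift e b) :=
  if pselect (exists j', s j j' /\ I2 j' (shift e b)) is left h
  then cbase B2 (shift e b) (sval (cid h)) else 0.

Lemma matched_vecE b j j' : s j j' -> matched_vec b j =
  if `[< I2 j' (shift e b) >] then cbase B2 (shift e b) j' else 0.
Proof.
move=> sj; rewrite /matched_vec; case: pselect => [h|h].
  case: (cid h) => i [/= si ib]; rewrite (sfun sj si) asboolT //.
by rewrite asboolF // => ib; apply: h; exists j'.
Qed.

Lemma unmatched_vecE b j : (forall j', ~ s j j') -> matched_vec b j = 0.
Proof.
by move=> ns; rewrite /matched_vec; case: pselect => // h; exfalso; case: h => j' [/ns].
Qed.

Lemma matched_hom : exists a : forall b, 'Hom(sp V b, sp W (shift e b)),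
  morph_shift a /\ forall b j, I1 j b -> a b (cbase B1 b j) = matched_vec b j.
Proof.
have H b := cid (chom B1 b (matched_vec b)).
pose a b := sval (H b); pose aP b := svalP (H b).
exists a; split=> [b b' bb'|b j jb]; last exact: aP.
apply: (chom_ext (c := B1)) => j jb.
rewrite !comp_lfunE (cmap _ bb') // (aP b) //.
have [[j' sj]|ns] := pselect (exists j', s j j'); last first.
  have ns' j' : ~ s j j' by move=> sj; apply: ns; exists j'.
  rewrite unmatched_vecE // linear0; case: asboolP => jb'; rewrite ?linear0 // (aP b') //.
  by rewrite unmatched_vecE.
rewrite (matched_vecE _ sj).
have nat := Ex_natural (@C1 j) (@C2 j') (sEx1 sj) (sEx2 sj) bb' jb.
have [j'b'|j'b'] := pselect (I2 j' (shift e b')).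
  have [j'b jb'] := nat j'b'.
  rewrite !asboolT // (cmap _ _ j'b) ?shift_mono // asboolT //.
  by rewrite (aP b') // (matched_vecE _ sj) asboolT.
transitivity (0 : sp W (shift e b')).
  by case: asboolP => j'b; rewrite ?linear0 // (cmap _ _ j'b) ?shift_mono // asboolF.
by case: asboolP => jb'; rewrite ?linear0 // (aP b') // (matched_vecE _ sj) asboolF.
Qed.

End OfMatching.

(** On unmatched bars both sides vanish by triviality. On a matched bar the composite returns to the
    bar if the partner contains the midpoint; otherwise the bar is dead after two shifts by
    [Ex_middle]. *)
Lemma matched_hom_comp V W (J1 J2 : eqType)
    (I1 : J1 -> set (bip R)) (I2 : J2 -> set (bip R))
    (B1 : coords V I1) (B2 : coords W I2) (e : R) (s : J1 -> J2 -> Prop)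
    (a : forall b, 'Hom(sp V b, sp W (shift e b)))
    (c : forall b, 'Hom(sp W b, sp V (shift e b))) :
  0 <= e -> (forall j', convexB (I2 j')) ->
  (forall j j1 j2, s j j1 -> s j j2 -> j1 = j2) ->
  (forall j1 j2 j', s j1 j' -> s j2 j' -> j1 = j2) ->
  (forall j j', s j j' -> I1 j `<=` Ex e (I2 j')) ->
  (forall j, (forall j', ~ s j j') -> trivial_mod (2 * e) (kI k (I1 j))) ->
  (forall b j, I1 j b -> a b (cbase B1 b j) = matched_vec B2 e s b j) ->
  (forall b j', I2 j' b -> c b (cbase B2 b j') = matched_vec B1 e (fun j' j => s j j') b j') ->
  forall b, (c (shift e b) \o a b)%VF = mp V b (shift e (shift e b)).
Proof.
move=> e0 C2 sfun sinj sEx triv aE cE b.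
apply: (chom_ext (c := B1)) => j jb.
have bb : ble b (shift e (shift e b)).
  by case: b {jb} => //= t [] /=; rewrite -addrA lerDl addr_ge0.
rewrite comp_lfunE (cmap _ bb) // aE //.
have [[j' sj]|ns] := pselect (exists j', s j j'); last first.
  have ns' j' : ~ s j j' by move=> sj; apply: ns; exists j'.
  rewrite unmatched_vecE // linear0 asboolF //.
  by move/trivial_kIP : (triv j ns') => /(_ b jb).
rewrite (matched_vecE B2 e sfun b sj); case: (asboolP (I2 j' (shift e b))) => j'b.
  rewrite cE //.
  exact: (matched_vecE (s := fun j' j => s j j') B1 e (fun j' j1 j2 => sinj j1 j2 j') _ sj).
rewrite linear0 asboolF // => jb2; apply: j'b.
exact: Ex_middle (@C2 j') (sEx _ _ sj) jb jb2.
Qed.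

Lemma interleaved_of_matching V W (J1 J2 : eqType)
    (I1 : J1 -> set (bip R)) (I2 : J2 -> set (bip R)) (e : R) :
  0 <= e -> barcode V I1 -> barcode W I2 ->
  Lmatching k e I1 I2 -> interleaved e V W.
Proof.
move=> e0 bV bW [s [[sfun sinj] [tr1 [tr2 sEx]]]].
have [B1 _] := barcode_coords bV; have [B2 _] := barcode_coords bW.
have C1 j : convexB (I1 j) by have [] := bV.1 j => _ [].
have C2 j : convexB (I2 j) by have [] := bW.1 j => _ [].
have sEx1 j j' (h : s j j') := (sEx j j' h).1.
have sEx2 j j' (h : s j j') := (sEx j j' h).2.
have sinj' j j1 j2 : s j1 j -> s j2 j -> j1 = j2 by exact: sinj.
have [a [am aE]] := matched_hom B1 B2 C1 C2 sfun sEx1 sEx2.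
(* The backward morphism is the same construction for the transposed relation. *)
have [c [cm cE]] := matched_hom (s := fun j' j => s j j') B2 B1 C2 C1 sinj'
  (fun j' j => @sEx2 j j') (fun j' j => @sEx1 j j').
exists a, c; split=> //; split=> //; split.
  exact: (matched_hom_comp e0 C2 sfun sinj sEx1 tr1 aE cE).
exact: (matched_hom_comp (s := fun j' j => s j j') e0 C1 sinj'
  (fun j1 j2 j' => @sfun j' j1 j2) (fun j' j => @sEx2 j j') tr2 cE aE).
Qed.

End BarcodeCoordinates.

(** * Kinds and cuts of intervals *)

Section Cuts.
Variable R : realType.
Implicit Types (I J K : set (bip R)) (C D E : set R) (b : bip R) (u v : R).

Variant kind := KAll | KDown | KUp | KLine of lane.

Definition ikind I : kind :=
  if pselect (I (bninf R)) then if pselect (I (bpinf R)) then KAll else KDown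
  else if pselect (I (bpinf R)) then KUp
  else if pselect (exists t, I (bpt t lane1)) then KLine lane1 else KLine lane2.

Variant kind_spec I : kind -> Prop :=
| SAll of (forall b, I b) : kind_spec I KAll
| SDown of I (bninf R) & ~ I (bpinf R) : kind_spec I KDown
| SUp of ~ I (bninf R) & I (bpinf R) : kind_spec I KUp
| SLine l of ~ I (bninf R) & ~ I (bpinf R) & (exists t, I (bpt t l)) &
    (forall t l', I (bpt t l') -> l' = l) : kind_spec I (KLine l).

(** The lanes communicate only through the two ends, so a path avoiding both ends never changes
    lane. *)
Lemma connected_lane I : connectedB I -> ~ I (bninf R) -> ~ I (bpinf R) ->
  forall t l s m, I (bpt t l) -> I (bpt s m) -> l = m.
Proof.
move=> cI In Ip t l s m It Is.
have [p [pI [pp lp]]] := cI _ _ It Is.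
elim: p t l It pI pp lp => [|[||r i] p IH] t l It pI; first by move=> _ /= [_ ->].
- by have := pI 0%N isT.
- by have := pI 0%N isT.
move=> /= /andP[+ pp lp]; have Ir := pI 0%N isT.
have pI' n : (n < size p)%N -> I (nth (bpt r i) p n).
  by move=> ns; rewrite (set_nth_default (bpt t l)) //; exact: pI n.+1 ns.
have <- : i = m by apply: (IH r i).
by rewrite /comparable /=; case: (l) (i) => [] [].
Qed.

Lemma ikindP I : intervalB I -> kind_spec I (ikind I).
Proof.
move=> [[b0 I0] [cI kI]]; rewrite /ikind.
case: pselect => In; case: pselect => Ip; try by constructor.
  by constructor => b; apply: (cI _ _ _ In Ip); case: b.
have lanes := connected_lane kI In Ip.
case: pselect => [[t It]|n1]; constructor => //.
- by exists t.
- by move=> s l' Is; exact: lanes Is It.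
- by case: b0 I0 => // t [] It; [case: n1; exists t|exists t].
- by move=> t [] It //; case: n1; exists t.
Qed.

(* The cuts are oriented so that, for every kind, nonzero morphisms k_I -> k_J(e)
   move both of them in the same direction; see [natural_coef_cuts]. *)
Definition cut1 I : set R := match ikind I with
  | KAll => set0
  | KDown => [set t | I (bpt t lane1)]
  | KUp => [set t | ~ I (bpt t lane1)]
  | KLine l => [set t | forall s, I (bpt s l) -> t < s]
  end.

Definition cut2 I : set R := match ikind I with
  | KAll => set0
  | KDown => [set t | I (bpt t lane2)]
  | KUp => [set t | ~ I (bpt t lane2)]
  | KLine l => [set t | exists2 s, I (bpt s l) & t <= s]
  end.

(* [cle u C D]: C is contained in the translate D + u. *)
Definition cle u C D := forall t, C (t + u) -> D t.
(** [clt (- u) D C] is exactly the failure of [cle u C D]. *)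
Definition clt u C D := exists2 t, D t & ~ C (t + u).
Definition downR C := forall s t, s <= t -> C t -> C s.

Lemma not_cle u C D : ~ cle u C D -> clt (- u) D C.
Proof.
move=> /existsNP[t /not_implyP[Ct nD]]; exists (t + u) => //.
by rewrite addrK.
Qed.

Lemma clt_le u C D : downR C -> downR D -> clt u C D -> cle u C D.
Proof.
move=> dC dD [t Dt nC] s Cs; have [st|/ltW ts] := leP s t; first exact: dD Dt.
by case: nC; apply: dC Cs; rewrite lerD2r.
Qed.

Lemma cle_trans u v C D E : cle u C D -> cle v D E -> cle (u + v) C E.
Proof. by move=> CD DE t Ct; apply/DE/CD; rewrite -addrA [v + u]addrC. Qed.

Lemma clt_cle_trans u v C D E : clt u C D -> cle v D E -> clt (u + v) C E.
Proof.
move=> [t Dt nC] DE; exists (t - v); first by apply: DE; rewrite subrK.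
by rewrite [u + v]addrC addrA subrK.
Qed.

Lemma cle_clt_trans u v C D E : cle u C D -> clt v D E -> clt (u + v) C E.
Proof.
move=> CD [t Et nD]; exists t => //; apply: contra_not nD.
by rewrite [u + v]addrC addrA; exact: CD.
Qed.

Lemma cut1_down I : intervalB I -> downR (cut1 I).
Proof.
move=> iI s t st; have [_ [cI _]] := iI; rewrite /cut1.
case: (ikindP iI) => //= [In _ It|_ Ip nI It|l _ _ _ _ h r /h]; last exact: le_lt_trans.
- by apply: (cI _ _ _ In It).
- by apply: nI; apply: (cI _ _ _ It Ip).
Qed.

Lemma cut2_down I : intervalB I -> downR (cut2 I).
Proof.
move=> iI s t st; have [_ [cI _]] := iI; rewrite /cut2.
case: (ikindP iI) => //= [In _ It|_ Ip nI It|l _ _ _ _ [r Ir tr]].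
- by apply: (cI _ _ _ In It).
- by apply: nI; apply: (cI _ _ _ It Ip).
- by exists r => //; exact: le_trans tr.
Qed.

Variable e : R.

Definition hom_cuts I J := cle e (cut1 J) (cut1 I) /\ cle e (cut2 J) (cut2 I).

Definition cut_match I J := [/\ ikind I = ikind J, hom_cuts I J & hom_cuts J I].

Lemma shift_bpt t l : shift e (bpt t l) = bpt (t + e) l.
Proof. by []. Qed.

Lemma cut_match_Ex I J : 0 <= e -> intervalB I -> intervalB J -> cut_match I J ->
  I `<=` Ex e J.
Proof.
move=> e0 iI iJ [kIJ [h1 h2] [h1' h2']] p Ip; have [_ [cJ _]] := iJ.
suff [[a Ja ap] [q Jq pq]] : (exists2 a, J (shift e a) & ble a p) /\
    (exists2 q, J q & ble p (shift e q)).
  by split; [exists a|exists (shift e q) => //; exists q].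
move: h1 h2 h1' h2'; rewrite /hom_cuts /cut1 /cut2 kIJ; move: kIJ.
case: (ikindP iJ) => [JA _ _ _ _ _|Jn Jp kI|Jn Jp kI|l Jn Jp _ Jl kI].
- by split; [exists (bninf R)|exists (bpinf R)]; rewrite // /ble; case: p {Ip}.
- move: Ip; have : ~ I (bpinf R) by move: kI; case: (ikindP iI).
  move=> nIp Ip h1 h2 h1' h2'; split; first by exists (bninf R) => //; case: p Ip.
  case: p Ip => [||t l] //; first by exists (bninf R).
  by case: l => It; [exists (bpt (t - e) lane1); first apply: h1'|
    exists (bpt (t - e) lane2); first apply: h2']; rewrite /= ?subrK.
- move: Ip; have : ~ I (bninf R) by move: kI; case: (ikindP iI).
  move=> nIp Ip h1 h2 h1' h2'; split; last by exists (bpinf R) => //; case: p Ip.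
  case: p Ip => [||t l] //; first by exists (bpinf R).
  by case: l => It; [exists (bpt t lane1)|exists (bpt t lane2)];
    rewrite /= ?lexx //; apply: contrapT; [move=> /h1|move=> /h2].
- have [nIn nIp Il] : [/\ ~ I (bninf R), ~ I (bpinf R) & forall t l', I (bpt t l') -> l' = l].
    by move: kI; case: (ikindP iI) => // m ? ? ? ? [<-].
  move=> h1 h2 h1' h2'; case: p Ip => [||t m] // It; have ml := Il _ _ It; subst m; split.
    (* Since [t] is not a strict lower bound of [I], neither is [t + e] of [J]; a point [s <= t + e]
       of [J] yields the lower witness [s - e]. *)
    have : ~ (forall s, J (bpt s l) -> t + e < s) by move=> /h1/(_ t It); rewrite ltxx.
    move=> /existsNP[s /not_implyP[Js /negP]]; rewrite -leNgt => st.
    exists (bpt (s - e) l); first by rewrite shift_bpt subrK.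
    by rewrite /= lerBlDr st; case: (l).
  have /h2' [s Js ts] : exists2 s, I (bpt s l) & t - e + e <= s by exists t; rewrite ?subrK.
  by exists (bpt s l) => //=; rewrite -lerBlDr ts; case: (l).
Qed.

(** On a lane, the cuts of [I] and [J] give a point of [J] below the midpoint, those of [J] and [K]
    one above. When [J] contains just one end, one of the two comparisons suffices. *)
Lemma hom_cuts_middle I J K b : intervalB I -> intervalB J -> intervalB K ->
  ikind I = ikind J -> ikind K = ikind J -> hom_cuts I J -> hom_cuts J K ->
  I b -> K (shift e (shift e b)) -> J (shift e b).
Proof.
move=> iI iJ iK kI kK; have [_ [cJ _]] := iJ.
rewrite /hom_cuts /cut1 /cut2 kI kK; move: kI kK.
case: (ikindP iJ) => [//|Jn Jp kI kK|Jn Jp kI kK|l Jn Jp _ Jl kI kK].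
- have nKp : ~ K (bpinf R) by move: kK; case: (ikindP iK).
  by move=> _ [h1 h2]; case: b => [||t [] _] //=; [exact: h1|exact: h2].
- have nIn : ~ I (bninf R) by move: kI; case: (ikindP iI).
  move=> [h1 h2] _; case: b => [||t l] //= It _; apply: contrapT.
  by case: l It => It; [move=> /h1|move=> /h2].
- have [nIn nIp Il] : [/\ ~ I (bninf R), ~ I (bpinf R) & forall t l', I (bpt t l') -> l' = l].
    by move: kI; case: (ikindP iI) => // m ? ? ? ? [<-].
  move=> [h1 h2] [h1' h2']; case: b => [||t m] // It; have ml := Il _ _ It; subst m.
  move=> Kt.
  have : ~ (forall s, J (bpt s l) -> t + e < s) by move=> /h1/(_ t It); rewrite ltxx.
  move=> /existsNP[s /not_implyP[Js /negP]]; rewrite -leNgt => st.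
  have /h2' [r Jr tr] : exists2 s, K (bpt s l) & t + e + e <= s by exists (t + e + e).
  by apply: (cJ _ _ _ Js Jr); rewrite /= ?st ?tr; case: (l).
Qed.

(** * Matrix entries of morphisms between interval modules *)

Section NaturalCoefficients.
Variable k : fieldType.

Definition natural_coef I J (c : bip R -> k) :=
  (forall b, c b != 0 -> I b /\ J (shift e b)) /\
  (forall b b', ble b b' -> I b -> J (shift e b') -> c b = c b').

Lemma natural_coef_ends I J c b : natural_coef I J c -> c b != 0 ->
  (I (bninf R) -> J (bninf R)) /\ (J (bpinf R) -> I (bpinf R)).
Proof.
move=> [cz cn] cb; have [Ib Jb] := cz b cb; split=> h.
  by have /cz[] : c (bninf R) != 0 by rewrite (cn (bninf R) b).
by have /cz[] : c (bpinf R) != 0 by rewrite -(cn b (bpinf R)) //; case: (b).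
Qed.

(** Along nonzero entries [bninf] can only be gained and [bpinf] only lost, so a path returning to
    its initial kind never left it; on a lane, the point [b] fixes the lane. *)
Lemma natural_coef_kind I J K c d b : intervalB I -> intervalB J -> intervalB K ->
  ikind I = ikind K -> natural_coef I J c -> natural_coef J K d ->
  c b != 0 -> d (shift e b) != 0 -> ikind J = ikind I.
Proof.
move=> iI iJ iK kIK nc nd cb db.
have [IJ JI] := natural_coef_ends nc cb; have [JK KJ] := natural_coef_ends nd db.
have [Ib Jb] := nc.1 b cb.
move: kIK; case: (ikindP iK); case: (ikindP iI) => //.
- by move=> IA KA _; case: (ikindP iJ) => // *; exfalso; auto.
- by move=> In Ip Kn Kp _; case: (ikindP iJ) => // *; exfalso; auto.
- by move=> In Ip Kn Kp _; case: (ikindP iJ) => // *; exfalso; auto.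
- move=> l In Ip _ Il m Kn Kp _ Km _; case: (ikindP iJ) => //.
  + by move=> h; exfalso; apply: Kn; apply: JK.
  + by move=> h; exfalso; apply: Kn; apply: JK.
  + by move=> _ h; exfalso; apply: Ip; apply: JI.
  + move=> n Jn Jp _ Jl; case: b Ib Jb {cb db} => // t i /Il -> /Jl ->; done.
Qed.

(** The overlap contains an end, comparable with every point, or lies in one totally ordered
    lane. *)
Lemma natural_coef_const I J c b b' : intervalB I -> intervalB J ->
  ikind I = ikind J -> natural_coef I J c ->
  I b -> J (shift e b) -> I b' -> J (shift e b') -> c b = c b'.
Proof.
move=> iI iJ kIJ [cz cn] Ib Jb Ib' Jb'.
case: (ikindP iI) kIJ; case: (ikindP iJ) => //.
- by move=> JA IA _; rewrite -(cn (bninf R) b) // (cn (bninf R) b').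
- by move=> Jn Jp In Ip _; rewrite -(cn (bninf R) b) // (cn (bninf R) b').
- move=> Jn Jp In Ip _; rewrite (cn b (bpinf R)) //; last by case: (b).
  by rewrite -(cn b' (bpinf R)) //; case: (b').
- move=> l Jn Jp _ Jl m In Ip _ Il _.
  case: b b' Ib Jb Ib' Jb' => [||s i] [||t j] // Is Js It Jt.
  have := Il _ _ Is; have := Il _ _ It => ? ?; subst i j.
  have [st|/ltW ts] := leP s t; first by apply: cn => //=; rewrite st; case: (m).
  by apply/esym/cn => //=; rewrite ts; case: (m).
Qed.

Lemma natural_coef_cuts I J c b : intervalB I -> intervalB J ->
  ikind I = ikind J -> natural_coef I J c -> c b != 0 -> hom_cuts I J.
Proof.
move=> iI iJ kIJ [cz cn] cb; have [Ib Jb] := cz b cb.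
rewrite /hom_cuts /cut1 /cut2; case: (ikindP iI) kIJ; case: (ikindP iJ) => //.
- by move=> _ _ _; split=> t.
- move=> Jn Jp In Ip _.
  have up b' : J (shift e b') -> I b'.
    move=> Jb'; have /cz[] // : c b' != 0.
    by rewrite -(cn (bninf R) b') // (cn (bninf R) b).
  by split=> t /=; exact: (up (bpt t _)).
- move=> Jn Jp In Ip _.
  have down b' : I b' -> J (shift e b').
    move=> Ib'; have /cz[] // : c b' != 0.
    rewrite (cn b' (bpinf R)) //; last by case: (b').
    by rewrite -(cn b (bpinf R)) //; case: (b).
  by split=> t /=; apply: contra_not; exact: (down (bpt t _)).
- move=> m Jn Jp _ Jl l In Ip _ Il [lm]; subst m.
  case: b Ib Jb cb => [||t0 i] // It0 Jt0 c0; have il := Il _ _ It0; subst i.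
  have bl s t : ble (bpt s l) (bpt t l) = (s <= t) by case: (l).
  (* The nonzero entry spreads from [t0] leftwards within [I] for the first cut, rightwards within
     the shifted [J] for the second. *)
  split=> t /=.
    move=> tJ s Is; have [st|ts] := leP s t0.
      have /cz[_ /tJ] : c (bpt s l) != 0 by rewrite (cn _ (bpt t0 l)) ?bl.
      by rewrite ltrD2r.
    by apply: lt_trans ts; rewrite -(ltrD2r e); exact: tJ.
  move=> [s Js ts]; have [st|st] := leP (t0 + e) s.
    exists (s - e); last by rewrite lerBrDr.
    have /cz[] // : c (bpt (s - e) l) != 0.
    by rewrite -(cn (bpt t0 l)) ?bl // ?lerBrDr //= subrK.
  by exists t0 => //; rewrite -(lerD2r e) ltW // (le_lt_trans ts).
Qed.

End NaturalCoefficients.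

End Cuts.

(** * Numerical keys of intervals and their lexicographic order *)

Section Keys.
Variable R : realType.
Implicit Types (I J K : set (bip R)) (C D E : set R) (u v : R).

(* The position of a cut is its supremum, refined by whether it is attained; cuts
   at infinity are compared first, through [level], and get position 0. *)
Let level C : R := if `[< C = set0 >] then -1 else if `[< C = setT >] then 1 else 0.
Let height C : R := if `[< C = set0 >] || `[< C = setT >] then 0 else sup C.
Let attained C : R :=
  if `[< C = set0 >] || `[< C = setT >] then 0 else (`[< C (sup C) >] : nat)%:R.

Variant key_spec C : R -> R -> R -> Prop :=
| KeyEmpty of (forall t, ~ C t) : key_spec C (-1) 0 0
| KeyFull of (forall t, C t) : key_spec C 1 0 0
| KeyClosed s of (forall t, C t <-> t <= s) : key_spec C 0 s 1
| KeyOpen s of (forall t, C t <-> t < s) : key_spec C 0 s 0.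

Lemma keyP C : downR C -> key_spec C (level C) (height C) (attained C).
Proof.
move=> dC; rewrite /level /height /attained.
case: asboolP => [->|/eqP/set0P C0] /=; first by apply: KeyEmpty => t.
case: asboolP => [->|CT] /=; first by apply: KeyFull.
have [r nCr] : exists r, ~ C r.
  apply: contrapT => h; apply: CT; apply/seteqP; split=> // t _.
  by apply: contrapT => nC; apply: h; exists t.
have supC : has_sup C.
  split=> //; exists r => t Ct; rewrite leNgt; apply/negP => /ltW rt.
  exact/nCr/(dC _ _ rt).
have ub t : C t -> t <= sup C by exact: sup_upper_bound.
have lt t : t < sup C -> C t.
  rewrite -subr_gt0 => t0; have [s Cs] := sup_adherent t0 supC.
  by rewrite subKr => /ltW ts; exact: dC Cs.
case: asboolP => Cs /=.
  apply: KeyClosed => t; split; first exact: ub.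
  by rewrite le_eqVlt => /orP[/eqP->//|/lt].
apply: KeyOpen => t; split=> [Ct|]; last exact: lt.
by rewrite lt_neqAle ub // andbT; apply: contra_notN Cs => /eqP <-.
Qed.

Lemma key_cle u C D : downR C -> downR D -> 0 <= u -> cle u C D ->
  level C < level D \/ level C = level D /\
  (height C < height D + u \/ height C = height D + u /\ attained C <= attained D).
Proof.
move=> dC dD u0 CD.
have CD' t : C t -> D (t - u) by move=> Ct; apply: CD; rewrite subrK.
have le_lteq (x y : R) : x <= y -> x < y \/ x = y.
  by rewrite le_eqVlt => /orP[/eqP|]; [right|left].
case: (keyP dC) => [hC|hC|s hC|s hC]; case: (keyP dD) => [hD|hD|r hD|r hD];
  try by left; lra.
- by right; split=> //; rewrite add0r; case: (le_lteq 0 u); [|left|right].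
- by case: (hD (0 - u)); exact/CD'/hC.
- by right; split=> //; rewrite add0r; case: (le_lteq 0 u); [|left|right].
- by have /hD := CD' (r + u + 1) (hC _); lra.
- by have /hD := CD' (r + u + 1) (hC _); lra.
- by case: (hD (s - u)); exact/CD'/hC.
- right; split=> //; have /CD'/hD : C s by exact/hC.
  by rewrite lerBlDr => /le_lteq[]; [left|right].
- right; split=> //; have /CD'/hD : C s by exact/hC.
  by rewrite ltrBlDr; left.
- by case: (hD (s - 1 - u)); apply/CD'/hC; lra.
- have sr : s <= r + u.
    rewrite leNgt; apply/negP => rs.
    (* If [r + u < s], the midpoint lies in [C], but its translate by [- u] exceeds the endpoint [r]
       of [D]. *)
    have /CD'/hD : C ((r + u + s) / 2) by apply/hC; lra.
    lra.
  by right; split=> //; case: (le_lteq _ _ sr); [left|right].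
- have sr : s <= r + u.
    rewrite leNgt; apply/negP => rs.
    have /CD'/hD : C ((r + u + s) / 2) by apply/hC; lra.
    lra.
  by right; split=> //; case: (le_lteq _ _ sr); [left|right].
Qed.

Lemma key_clt u C D : downR C -> downR D -> u <= 0 -> clt u C D ->
  level C < level D \/ level C = level D /\
  (height C < height D + u \/ height C = height D + u /\ attained C < attained D).
Proof.
move=> dC dD u0 [t].
case: (keyP dC) => [hC|hC|s hC|s hC]; case: (keyP dD) => [hD|hD|r hD|r hD];
  try by left; lra.
- by move=> /hD.
- by move=> /hD.
- by move=> _ /(_ (hC _)).
- by move=> _ /(_ (hC _)).
- by move=> _ /(_ (hC _)).
- by move=> /hD.
- move=> /hD tr nC; right; split=> //; left.
  have : ~ (t + u <= s) by move/hC.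
  by move=> /negP; rewrite -ltNge; lra.
- move=> /hD tr nC; right; split=> //; left.
  have : ~ (t + u <= s) by move/hC.
  by move=> /negP; rewrite -ltNge; lra.
- by move=> /hD.
- move=> /hD tr nC; right; split=> //.
  have : ~ (t + u < s) by move/hC.
  move=> /negP; rewrite -leNgt => st.
  have : s <= r + u by lra.
  by rewrite le_eqVlt => /orP[/eqP|]; [right; split=> //; lra|left].
- move=> /hD tr nC; right; split=> //; left.
  have : ~ (t + u < s) by move/hC.
  by move=> /negP; rewrite -leNgt; lra.
Qed.

(** Adding the two triples componentwise lets a rise by [u] of one cut cancel a drop by [u] of the
    other, while a strict inequality on either cut survives. *)
Definition key I : R *l (R *l R) :=
  (level (cut1 I) + level (cut2 I),
   (height (cut1 I) + height (cut2 I), attained (cut1 I) + attained (cut2 I))).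

Lemma ltkeyP (x1 x2 x3 y1 y2 y3 : R) :
  x1 < y1 \/ x1 = y1 /\ (x2 < y2 \/ x2 = y2 /\ x3 < y3) ->
  (((x1, (x2, x3)) : R *l (R *l R)) < ((y1, (y2, y3)) : R *l (R *l R)))%O.
Proof.
rewrite !Order.ProdLexiOrder.ltxi_pair => -[xy|[-> [xy|[-> xy]]]].
- by rewrite ltW // leNgt xy.
- by rewrite lexx /= ltW // leNgt xy.
- by rewrite !lexx.
Qed.

Lemma key_lt12 u I J : intervalB I -> intervalB J -> 0 <= u ->
  clt (- u) (cut1 I) (cut1 J) -> cle u (cut2 I) (cut2 J) -> (key I < key J)%O.
Proof.
move=> iI iJ u0 lt1 le2; apply: ltkeyP.
have := key_clt (cut1_down iI) (cut1_down iJ) _ lt1; rewrite oppr_le0 => /(_ u0).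
have := key_cle (cut2_down iI) (cut2_down iJ) u0 le2.
move=> [?|[? [?|[? ?]]]] [?|[? [?|[? ?]]]];
  first [by left; lra | right; split; [lra|
  first [by left; lra | right; split; lra]]].
Qed.

Lemma key_lt21 u I J : intervalB I -> intervalB J -> 0 <= u ->
  cle u (cut1 I) (cut1 J) -> clt (- u) (cut2 I) (cut2 J) -> (key I < key J)%O.
Proof.
move=> iI iJ u0 le1 lt2; apply: ltkeyP.
have := key_clt (cut2_down iI) (cut2_down iJ) _ lt2; rewrite oppr_le0 => /(_ u0).
have := key_cle (cut1_down iI) (cut1_down iJ) u0 le1.
move=> [?|[? [?|[? ?]]]] [?|[? [?|[? ?]]]];
  first [by left; lra | right; split; [lra|
  first [by left; lra | right; split; lra]]].
Qed.

Variable e : R.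
Hypothesis e0 : 0 <= e.

(* If J is matched neither with I nor with K, then each of the two failures
   makes one cut of K drop, and the other cut cannot compensate. *)
Lemma hom_cuts_match I J K : intervalB I -> intervalB J -> intervalB K ->
  hom_cuts e I J -> hom_cuts e J K -> ~~ (key K < key I)%O ->
  hom_cuts e J I \/ hom_cuts e K J.
Proof.
move=> iI iJ iK [IJ1 IJ2] [JK1 JK2] nlt.
have [?|nJI] := pselect (hom_cuts e J I); first by left.
have [?|nKJ] := pselect (hom_cuts e K J); first by right.
have dI1 := cut1_down iI; have dI2 := cut2_down iI.
have dJ1 := cut1_down iJ; have dJ2 := cut2_down iJ.
have dK1 := cut1_down iK; have dK2 := cut2_down iK.
have e20 : 0 <= e + e by exact: addr_ge0.
case/negP: nlt.
have KI1 := cle_trans JK1 IJ1; have KI2 := cle_trans JK2 IJ2.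
move/not_andP : nJI => [/not_cle JI1|/not_cle JI2];
move/not_andP : nKJ => [/not_cle KJ1|/not_cle KJ2].
(* Failures on the same cut add up to a strict drop by [e + e], whereas the composite lets the other
   cut rise by at most [e + e]. *)
- apply: key_lt12 e20 _ KI2 => //; rewrite opprD; apply: clt_cle_trans KJ1 _.
  exact: clt_le JI1.
(* Failures on different cuts: on each cut a rise by [e] and a drop by [e] cancel, leaving a strict
   decrease. *)
- apply: (@key_lt12 0) => //.
    by have := cle_clt_trans JK1 JI1; rewrite subrr oppr0.
  by have := clt_cle_trans KJ2 IJ2; rewrite addNr; apply: clt_le.
- apply: (@key_lt12 0) => //.
    by have := clt_cle_trans KJ1 IJ1; rewrite addNr oppr0.
  by have := cle_clt_trans JK2 JI2; rewrite subrr; apply: clt_le.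
- apply: key_lt21 e20 KI1 _ => //; rewrite opprD; apply: clt_cle_trans KJ2 _.
  exact: clt_le JI2.
Qed.

(** Kinds containing an end are immediate. On a lane, if no such [b] exists, [K] stops before
    [t0 + e + e] and [I] starts after [t1], so both cuts of [K] lie strictly below those of [I],
    against the order of the keys. *)
Lemma hom_cuts_comp I J K : intervalB I -> intervalB J -> intervalB K ->
  ikind I = ikind K -> ikind J = ikind K ->
  (exists2 b, I b & I (shift e (shift e b))) ->
  (exists2 b, K b & K (shift e (shift e b))) ->
  hom_cuts e I J -> hom_cuts e J K -> ~~ (key K < key I)%O ->
  exists2 b, I b & K (shift e (shift e b)).
Proof.
move=> iI iJ iK kIK kJK [p Ip Ip2] [q Kq Kq2] [IJ1 IJ2] [JK1 JK2] nlt.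
have KI1 := cle_trans JK1 IJ1; have KI2 := cle_trans JK2 IJ2.
have [_ [cI _]] := iI; have [_ [cK _]] := iK.
case kKe: _ / (ikindP iK) kIK => [KA|Kn _|_ Kp|l Kn Kp _ Kl] kI.
- by exists p.
- by exists (bninf R) => //; move: kI; case: (ikindP iI).
- by exists (bpinf R) => //; move: kI; case: (ikindP iI).
have ble_lane s t : ble (bpt s l) (bpt t l) = (s <= t) by case: (l).
have [In Ip' Il] : [/\ ~ I (bninf R), ~ I (bpinf R) & forall t l', I (bpt t l') -> l' = l].
  by move: kI; case: (ikindP iI) => // m ? ? ? ? [<-].
apply: contrapT => noIK; case/negP: nlt.
case: p Ip Ip2 => [||t0 i] // It0; have il := Il _ _ It0; subst i => /= It0'.
case: q Kq Kq2 => [||t1 i] // Kt1; have il := Kl _ _ Kt1; subst i => /= Kt1'.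
have nK2 : ~ cut2 K (t0 + e + e).
  rewrite /cut2 kKe => -[r Kr tr].
  have : ~ cut1 K (t0 + (e + e)) by move=> /KI1; rewrite /cut1 kI => /(_ t0 It0); rewrite ltxx.
  rewrite /cut1 kKe => /existsNP[s /not_implyP[Ks /negP]]; rewrite -leNgt addrA => st.
  apply: noIK; exists (bpt t0 l) => //=.
  by apply: (cK _ _ _ Ks Kr); rewrite ble_lane.
have t10 : t1 < t0.
  rewrite -(ltrD2r e) -(ltrD2r e) ltNge; apply/negP => h; apply: nK2.
  by rewrite /cut2 kKe; exists (t1 + e + e).
have nI1 : ~ I (bpt t1 l) by move=> It1; apply: noIK; exists (bpt t1 l).
apply: (@key_lt12 0) => //.
  exists t1; last by rewrite /cut1 kKe => /(_ t1 Kt1); rewrite oppr0 addr0 ltxx.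
  rewrite /cut1 kI /= => s Is; rewrite ltNge; apply/negP => st1; apply: nI1.
  by apply: (cI _ _ _ Is It0); rewrite ble_lane // ltW.
apply: clt_le; [exact: cut2_down|exact: cut2_down|].
exists (t0 + e + e); last by rewrite addr0.
by rewrite /cut2 kI; exists (t0 + e + e).
Qed.

End Keys.

(** * Unitriangular matrices and Hall's condition *)

Lemma eq_big_support (R : nmodType) (T : eqType) (r1 r2 : seq T) (F1 F2 : T -> R) :
  uniq r1 -> uniq r2 -> {in r2, F1 =1 F2} ->
  (forall x, F1 x != 0 -> x \in r1 /\ x \in r2) ->
  \sum_(x <- r1) F1 x = \sum_(x <- r2) F2 x.
Proof.
move=> u1 u2 F12 supp; rewrite -(eq_big_seq _ F12).
rewrite (bigID (fun x => F1 x != 0)) [RHS](bigID (fun x => F1 x != 0)) /=.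
rewrite [X in _ + X]big1 => [|x /negPn/eqP//].
rewrite [X in _ = _ + X]big1 => [|x /negPn/eqP//].
rewrite !addr0 -big_filter -[RHS]big_filter; apply: perm_big.
apply: uniq_perm; rewrite ?filter_uniq // => x; rewrite !mem_filter.
by case: eqVneq => //= /supp[-> ->].
Qed.

Section Counting.
Variables (R : realType) (k : fieldType) (e : R) (J1 J2 : eqType).
Variables (I1 : J1 -> set (bip R)) (I2 : J2 -> set (bip R)).
Hypotheses (e0 : 0 <= e).
Hypotheses (iI1 : forall j, intervalB (I1 j)) (iI2 : forall j', intervalB (I2 j')).
Variable supp : bip R -> seq J2.
Hypotheses (supp_uniq : forall b, uniq (supp b)).
Hypotheses (suppP : forall b j', I2 j' b <-> j' \in supp b).
Variables (c : bip R -> J1 -> J2 -> k) (d : bip R -> J2 -> J1 -> k).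
Hypothesis cN : forall j j', natural_coef e (I1 j) (I2 j') (fun b => c b j j').
Hypothesis dN : forall j' j, natural_coef e (I2 j') (I1 j) (fun b => d b j' j).
Hypothesis cd : forall b j i, I1 j b -> I1 i (shift e (shift e b)) ->
  \sum_(j' <- supp (shift e b)) c b j j' * d (shift e b) j' i = (j == i)%:R.

Definition persistent I := exists2 b : bip R, I b & I (shift e (shift e b)).

(** By [natural_coef_const] an entry between bars of equal kind is constant on their overlap, so the
    chosen point is immaterial. *)
Definition scalar (I J : set (bip R)) (f : bip R -> k) : k :=
  if pselect (ikind I = ikind J /\ exists b, I b /\ J (shift e b)) is left h
  then f (sval (cid h.2)) else 0.

Lemma scalarE I J f b : intervalB I -> intervalB J -> natural_coef e I J f ->
  ikind I = ikind J -> I b -> J (shift e b) -> scalar I J f = f b.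
Proof.
move=> iI iJ fN kIJ Ib Jb; rewrite /scalar.
case: pselect => [h|[]]; last by split=> //; exists b.
by case: cid => b' [Ib' Jb'] /=; apply: natural_coef_const fN _ _ _ _.
Qed.

Lemma scalar_neq0 I J f : intervalB I -> intervalB J -> natural_coef e I J f ->
  scalar I J f != 0 -> ikind I = ikind J /\ hom_cuts e I J.
Proof.
move=> iI iJ fN; rewrite /scalar; case: pselect => [h f0|_ /eqP//].
by have [kIJ _] := h; split=> //; exact: natural_coef_cuts fN f0.
Qed.

Let w j j' := scalar (I1 j) (I2 j') (fun b => c b j j').
Let u j' j := scalar (I2 j') (I1 j) (fun b => d b j' j).
Let matched j j' := cut_match e (I1 j) (I2 j').

(** This is [cd] cut down to one kind and to possible partners: detours through another kind vanish
    by [natural_coef_kind], and with this order of keys [hom_cuts_match] makes every [j'] with a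
    nonzero term a partner of [j] or [i]. If no point links the two bars, [hom_cuts_comp] kills all
    terms. *)
Lemma scalar_product j i (Q : seq J2) :
  persistent (I1 j) -> persistent (I1 i) -> uniq Q ->
  (forall j', matched j j' \/ matched i j' -> j' \in Q) ->
  ~~ (key (I1 i) < key (I1 j))%O ->
  \sum_(j' <- Q) w j j' * u j' i = (j == i)%:R.
Proof.
move=> pj pi uQ QP nlt.
have wu j' : w j j' * u j' i != 0 -> [/\ ikind (I1 j) = ikind (I2 j'),
    ikind (I2 j') = ikind (I1 i), hom_cuts e (I1 j) (I2 j') & hom_cuts e (I2 j') (I1 i)].
  rewrite mulf_eq0 negb_or => /andP[w0 u0].
  have [k1 h1] := scalar_neq0 (iI1 j) (iI2 j') (@cN j j') w0.
  by have [k2 h2] := scalar_neq0 (iI2 j') (iI1 i) (@dN j' i) u0.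
have [[b jb ib]|nob] := pselect (exists2 b, I1 j b & I1 i (shift e (shift e b))); last first.
  have [ij|ij] := eqVneq j i; first by case: nob; case: pj => b; exists b => //; rewrite -ij.
  apply: big1 => j' _; apply/eqP; apply: contra_notT nob => /wu[k1 k2 h1 h2].
  by apply: (hom_cuts_comp (iI1 j) (iI2 j') (iI1 i)); rewrite // k1.
have [kji|kji] := pselect (ikind (I1 j) = ikind (I1 i)); last first.
  have [ij|ij] := eqVneq j i; first by rewrite ij in kji.
  apply: big1 => j' _; apply/eqP; apply: contra_notT kji => /wu[-> ->]; done.
rewrite -(cd jb ib); apply: eq_big_support => //.
  move=> j' /suppP jb'.
  have [kj'|kj'] := pselect (ikind (I1 j) = ikind (I2 j')).
    rewrite /w (scalarE (b := b) _ _ (@cN j j')) //.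
    by rewrite /u (scalarE (b := shift e b) _ _ (@dN j' i)) // -kj'.
  rewrite {1}/w /scalar; case: pselect => [[]//|_]; rewrite mul0r.
  apply/esym/eqP; apply: contra_notT kj'; rewrite mulf_eq0 negb_or => /andP[c0 d0].
  exact/esym/(natural_coef_kind (iI1 j) (iI2 j') (iI1 i) kji (@cN j j') (@dN j' i) c0 d0).
move=> j' /wu[k1 k2 h1 h2]; split.
  apply: QP; have [h|h] := hom_cuts_match e0 (iI1 j) (iI2 j') (iI1 i) h1 h2 nlt.
    by left; split.
  by right; split.
by apply/suppP; apply: (hom_cuts_middle (I := I1 j) (K := I1 i)) h1 h2 jb ib.
Qed.

(** By [hom_cuts_middle] every partner contains the midpoint of a persistence witness, so the finite
    support there lists them all. *)
Definition neighbours j : seq J2 :=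
  if pselect (persistent (I1 j)) is left h
  then [seq j' <- supp (shift e (sval (cid2 h))) | `[< matched j j' >]] else [::].

Lemma mem_neighbours j j' : persistent (I1 j) ->
  (j' \in neighbours j) = `[< matched j j' >].
Proof.
rewrite /neighbours; case: pselect => // h _; case: cid2 => b /= jb jb2.
rewrite mem_filter; case: asboolP => //= -[k1 h1 h2]; apply/suppP.
by apply: (hom_cuts_middle (I := I1 j) (K := I1 j)) h1 h2 jb jb2.
Qed.

(* The scalars of the two morphisms between the bars in B and their possible
   partners multiply, in the order of the keys, to a unitriangular matrix. *)
Lemma neighbours_hall : hall_cond neighbours (fun j => persistent (I1 j)).
Proof.
move=> B uB pB; pose A := sort (relpre (fun j => key (I1 j)) <=%O) B.
have AB : A =i B by move=> x; rewrite mem_sort.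
have uA : uniq A by rewrite sort_uniq.
have sA : sorted (relpre (fun j => key (I1 j)) <=%O) A.
  by apply: sort_sorted => x y; exact: le_total.
rewrite -(size_sort (relpre (fun j => key (I1 j)) <=%O)) -/A.
set Q := nbh neighbours B; have uQ : uniq Q by exact: undup_uniq.
pose a i := tnth (in_tuple A) i.
have aB i : a i \in B by rewrite -AB mem_tnth.
have a_inj : injective a by exact/(tuple_uniqP (in_tuple A)).
pose M := \matrix_(i < size A, t < size Q) w (a i) (tnth (in_tuple Q) t).
pose N := \matrix_(t < size Q, i < size A) u (tnth (in_tuple Q) t) (a i).
(* As [A] is sorted, [i <= t] gives the key comparison; the entries below the diagonal do not affect
   the determinant. *)
have MN (i t : 'I_(size A)) : (i <= t)%N -> (M *m N) i t = (i == t)%:R.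
  move=> it; rewrite mxE; under eq_bigr do rewrite !mxE.
  rewrite -(big_tnth _ _ Q xpredT (fun j' => w (a i) j' * u j' (a t))).
  rewrite scalar_product //; first by rewrite (inj_eq a_inj).
  - exact: pB.
  - exact: pB.
  - by move=> j' h; apply/mem_nbh; case: h => h; [exists (a i)|exists (a t)];
      rewrite ?mem_neighbours; try exact: pB; try exact/asboolP; exact: aB.
  - rewrite -leNgt; have x0 := a i; rewrite /a !(tnth_nth x0) /=.
    apply: (sorted_leq_nth _ _ x0 sA) => //.
    + by move=> x y z /=; exact: le_trans.
    + by move=> x /=; exact: lexx.
    + by rewrite inE.
    + by rewrite inE.
have : (M *m N) \in unitmx.
  rewrite unitmxE det_trig; last first.
    by apply/is_trig_mxP => i t it; rewrite MN ?(ltnW it) // -val_eqE ltn_eqF.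
  by rewrite big1 ?unitr1 // => i _; rewrite MN // eqxx.
(* Full rank of the product bounds [size A] by the inner dimension [size Q]. *)
move=> /mxrank_unit r; rewrite -[X in (X <= _)%N]r.
exact: leq_trans (mxrankM_maxl _ _) (rank_leq_col _).
Qed.

Lemma persistent_matching : exists f : J1 -> J2 -> Prop,
  [/\ forall j, persistent (I1 j) -> exists j', f j j',
      forall j j', f j j' -> cut_match e (I1 j) (I2 j'),
      forall j i i', f j i -> f j i' -> i = i' &
      forall j j' i, f j i -> f j' i -> j = j'].
Proof.
have [f [f1 f2 f3 f4]] := locally_finite_hall neighbours_hall.
exists f; split=> // j j' /f2[pj]; rewrite mem_neighbours //.
by move=> /asboolP.
Qed.

End Counting.

(** * From interleavings to matchings *)

Lemma matching_of_interleaved (R : realType) (k : fieldType) (V W : pmod R k)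
    (J1 J2 : eqType) (I1 : J1 -> set (bip R)) (I2 : J2 -> set (bip R)) (e : R) :
  0 <= e -> barcode V I1 -> barcode W I2 ->
  interleaved e V W -> Lmatching k e I1 I2.
Proof.
move=> e0 bV bW [a [c [am [cm [ca ac]]]]].
have [B1 _] := barcode_coords bV; have [B2 _] := barcode_coords bW.
have [iI1 _] := bV; have [iI2 _] := bW.
have aN j j' : natural_coef e (I1 j) (I2 j') (fun b => hom_coef B1 B2 a b j j').
  by split=> [b|b b']; [exact: hom_coef_neq0|exact: hom_coef_natural].
have cN j j' : natural_coef e (I2 j) (I1 j') (fun b => hom_coef B2 B1 c b j j').
  by split=> [b|b b']; [exact: hom_coef_neq0|exact: hom_coef_natural].
have [f [f1 f2 f3 f4]] := persistent_matching e0 iI1 iI2 (csupp_uniq B2) (csuppP B2)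
  aN cN (fun b j i => hom_coef_comp B1 B2 e0 (ca b)).
have [g [g1 g2 g3 g4]] := persistent_matching e0 iI2 iI1 (csupp_uniq B1) (csuppP B1)
  cN aN (fun b j i => hom_coef_comp B2 B1 e0 (ac b)).
(* [f] covers the persistent bars of [V] and [g] those of [W]; a matching covering both leaves only
   trivial bars unmatched. *)
have [s [sb s1 s2 sfg]] := merge_matchings f1 g1 f3 f4 g3 g4.
exists s; split=> //; split; [|split].
- move=> j ns; apply/trivial_kIP => b jb jb2.
  by have [|j' /ns] := s1 j; first by exists b.
- move=> j' ns; apply/trivial_kIP => b jb jb2.
  by have [|j /ns] := s2 j'; first by exists b.
- move=> j j' /sfg fg; have [k1 h1 h2] : cut_match e (I1 j) (I2 j').
    by case: fg => [/f2//|/g2[kk ? ?]]; split.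
  by split; apply: cut_match_Ex.
Qed.

(** * Interval modules as barcodes with one bar *)

Section IntervalModules.
Variables (R : realType) (k : fieldType).
Implicit Types I J : set (bip R).

Lemma basis_rV_bool (m : bool) : basis_of {: 'rV[k]_(m : nat)}
  [seq const_mx 1 | _ <- if m then [:: tt] else [::]].
Proof.
rewrite basisEfree subvf dimvf /dim /= mul1n; case: m => /=.
  rewrite seq1_free andbT; apply/eqP => /matrixP/(_ ord0 ord0)/eqP.
  by rewrite !mxE oner_eq0.
by rewrite nil_free.
Qed.

Lemma barcode_kI I : intervalB I -> barcode (kI k I) (fun _ : unit => I).
Proof.
move=> iI; split=> //; exists (fun b _ => const_mx 1); split=> [b|b b' [] bb' Ib].
  exists (if `[< I b >] then [:: tt] else [::]); split=> [[]|].
    by case: asboolP => Ib; split.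
  exact: basis_rV_bool.
rewrite lfunE /=; apply/matrixP => i j; rewrite !mxE; case: (asboolP (I b')) j => Ib' /= j.
  under eq_bigr do rewrite !mxE mul1r.
  by rewrite sumr_const card_ord asboolT // mxE.
by case: j.
Qed.

(** A partial bijection between two singletons is full or empty. *)
Lemma interleaved_kI (e : R) I J : 0 <= e -> intervalB I -> intervalB J ->
  interleaved e (kI k I) (kI k J) ->
  (I `<=` Ex e J /\ J `<=` Ex e I) \/
  (trivial_mod (2 * e) (kI k I) /\ trivial_mod (2 * e) (kI k J)).
Proof.
move=> e0 iI iJ /(matching_of_interleaved e0 (barcode_kI iI) (barcode_kI iJ)).
move=> [s [_ [tI [tJ sP]]]]; have [h|h] := pselect (s tt tt); first by left; exact: sP h.
by right; split; [apply: (tI tt)|apply: (tJ tt)] => -[].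
Qed.

End IntervalModules.

Theorem theorem4p2 (R : realType) (k : fieldType) (V W : pmod R k)
    (J1 J2 : eqType) (I1 : J1 -> set (bip R)) (I2 : J2 -> set (bip R)) :
  is_module V -> is_module W -> barcode V I1 -> barcode W I2 ->
  (forall e : R, 0 <= e ->
     (Lmatching k e I1 I2 <-> bottleneck k e I1 I2) /\
     (bottleneck k e I1 I2 <-> interleaved e V W)) /\
  dI V W = dBI k I1 I2 /\ dBI k I1 I2 = dB k I1 I2.
Proof.
move=> _ _ bV bW; have [iI1 _] := bV; have [iI2 _] := bW.
have main (e : R) : 0 <= e ->
    (Lmatching k e I1 I2 <-> bottleneck k e I1 I2) /\
    (bottleneck k e I1 I2 <-> interleaved e V W).
  move=> e0.
  have ab : Lmatching k e I1 I2 <-> bottleneck k e I1 I2.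
    split=> [|] [s [sb [s1 [s2 sP]]]].
      exists s; do 3!split=> //; move=> j j' /sP P.
      apply: (interleaved_of_matching e0 (barcode_kI k (iI1 j)) (barcode_kI k (iI2 j'))).
      exists (fun _ _ => True); split; first by split=> -[] [] [].
      by split; [|split] => // -[] /(_ tt).
    exists (fun j j' => s j j' /\ I1 j `<=` Ex e (I2 j') /\ I2 j' `<=` Ex e (I1 j)).
    split; [|split; [|split]] => [|j ns|j' ns|j j' []//].
    - split=> [j j1 j2 [h _] [h' _]|j1 j2 j [h _] [h' _]].
        exact: sb.1 h h'.
      exact: sb.2 h h'.
    - have [[j' sj]|ns'] := pselect (exists j', s j j'); last first.
        by apply: s1 => j' sj; apply: ns'; exists j'.
      by have [P|[]//] := interleaved_kI e0 (iI1 j) (iI2 j') (sP _ _ sj); case: (ns j').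
    - have [[j sj]|ns'] := pselect (exists j, s j j'); last first.
        by apply: s2 => j sj; apply: ns'; exists j.
      by have [P|[]//] := interleaved_kI e0 (iI1 j) (iI2 j') (sP _ _ sj); case: (ns j).
  split=> //; rewrite -ab; split; first exact: interleaved_of_matching.
  exact: matching_of_interleaved.
split=> //; rewrite /dI /dBI /dB /dinf; split; congr (ereal_inf (image _ _));
  apply/seteqP; split=> x [x0 h]; split=> //; move: h; have [ab bc] := main x x0.
- by move/bc.
- by move/bc.
- by move/ab.
- by move/ab.
Qed.
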